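(* There exists a positive integer $n_0$ such that each of the sequences $(M_n^{1/n})_{n\ge n_0}$, $(S_n^{1/n})_{n\ge n_0}$ and $(\mathrm{Tr}_n^{1/n})_{n\ge n_0}$ is strictly increasing, while each of the sequences $$\left(\frac{M_{n+1}^{1/(n+1)}}{M_n^{1/n}}\right)_{n\ge n_0},\qquad \left(\frac{S_{n+1}^{1/(n+1)}}{S_n^{1/n}}\right)_{n\ge n_0},\qquad \left(\frac{\mathrm{Tr}_{n+1}^{1/(n+1)}}{\mathrm{Tr}_n^{1/n}}\right)_{n\ge n_0}$$ is strictly decreasing.
   Context: The $n$th Motzkin number is $M_n=\sum_{k=0}^{\lfloor n/2\rfloor}\binom{n}{2k}\binom{2k}{k}\frac{1}{k+1}$. The $n$th Schröder number is $S_n=\sum_{k=0}^n\binom{n}{k}\binom{n+k}{k}\frac{1}{k+1}$. The $n$th trinomial coefficient $\mathrm{Tr}_n$ is the coefficient of $x^n$ in the expansion of $(x^2+x+1)^n$, given by $\mathrm{Tr}_n=\sum_{k=0}^n\binom{n}{k}\binom{n-k}{k}$ (with $\binom{a}{b}=0$ when $0\le a<b$). *)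

(* Defs.v *)
From mathcomp Require Import all_boot all_order all_algebra.
From mathcomp Require Import all_reals all_analysis.

Set Implicit Arguments.
Unset Strict Implicit.
Unset Printing Implicit Defensive.

Import Order.TTheory GRing.Theory Num.Theory.

Local Open Scope ring_scope.

Definition motzkin (R : realType) (n : nat) : R :=
  \sum_(k < (n./2).+1) 'C(n, 2 * k)%:R * 'C(2 * k, k)%:R / k.+1%:R.

Definition schroder (R : realType) (n : nat) : R :=
  \sum_(k < n.+1) 'C(n, k)%:R * 'C(n + k, k)%:R / k.+1%:R.

Definition trinomial (R : realType) (n : nat) : R :=
  (('X^2 + 'X + 1 : {poly R}) ^+ n)`_n.

(* Used only for n > 0: at n = 0 the exponent 0^-1 is 0 by convention. *)
Definition nth_root_seq (R : realType) (a : nat -> R) (n : nat) : R :=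
  a n `^ n%:R^-1.

Definition ratio_seq (R : realType) (a : nat -> R) (n : nat) : R :=
  a n.+1 / a n.

(* Main.v *)
Require Import Defs.
From mathcomp Require Import all_boot all_order all_algebra.
From mathcomp Require Import all_reals all_analysis.
From mathcomp Require Import ring lra zify.

(** Write L n = ln (a n). The n-th root of a n is exp (L n / n), so the roots
    increase when the gap n L(n+1) - (n+1) L n is positive, and since
    L(n+1)/(n+1) - L n / n = gap n / (n (n+1)), their ratios decrease when
    2 gap n > n (n+1) (r(n+1) - r n), where r n = L(n+1) - L n is the slope.
    Moreover gap (n+1) - gap n = (n+1) (r(n+1) - r n). Hence it is enough that
    r(n+1) - r n lies between two positive constants over n^2: the increments
    of the gap are then at least of order 1/n, the gap grows like ln n, and it
    overtakes the bounded quantity n (n+1) (r(n+1) - r n)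
    (roots_ratios_of_slope).

    The three sequences behave like lam^n n^(-al), with quotients
    a(n+1)/a(n) = lam (1 - al/n + O(1/n^2)). A quotient trapped between
    lam (1 - al/(n+s)) and lam (1 - al/(n+t)) with s <= t < s + 1 gives the
    estimate on the slopes: the worst case compares n + t with n + 1 + s
    (slope_of_window). So the quotients need to be known to order 1/n^2 only
    up to a fixed error, and explicit rational s and t suffice.

    To trap the quotients, all three sequences are read off the powers of
    Q = 1 + p X + q X^2. The coefficient of X^n in Q^n is the trinomial
    coefficient for (p, q) = (1, 1). The coefficient of X^(n+1) in Q^n, divided
    by n, is the Motzkin number of index n-1 for (1, 1) and the Schroder number
    of index n for (3, 2). The identity Q (Q^n)' = n Q' Q^n makes these two
    coefficients a first-order linear system in n, and eliminating either one
    leaves, for the first and for the second divided by n, a recurrence of the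
    common shape three_term with lam = p + 2 sqrt q, mu = p - 2 sqrt q, and
    al = 1/2 or 3/2. Along such a recurrence the distance to an edge of the
    window satisfies the exact identity defectS, whose inhomogeneous term has an
    affine function of n as its only factor of variable sign; the windows are
    therefore preserved as soon as the signs of two such functions are right,
    and one initial index starts the induction. *)

Set Implicit Arguments.
Unset Strict Implicit.
Import Order.TTheory GRing.Theory Num.Theory.
Local Open Scope ring_scope.

(** * Central coefficients of powers of a quadratic polynomial *)

Section QuadraticPowers.
Variable R : realFieldType.
Implicit Types p q : R.

Definition quad p q : {poly R} := q *: 'X^2 + p *: 'X + 1.
Definition central p q n : R := (quad p q ^+ n)`_n.
Definition next_central p q n : R := (quad p q ^+ n)`_n.+1.

Lemma coef1_quadM p q (P : {poly R}) :
  (quad p q * P)`_1 = P`_1 + p * P`_0.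
Proof.
rewrite /quad !mulrDl mul1r !coefD -!scalerAl !coefZ.
by rewrite -['X^2 * P]commr_polyXn -['X * P]commr_polyX coefMXn coefMX /=; ring.
Qed.

Lemma coef_quadM p q (P : {poly R}) k :
  (quad p q * P)`_k.+2 = P`_k.+2 + p * P`_k.+1 + q * P`_k.
Proof.
rewrite /quad !mulrDl mul1r !coefD -!scalerAl !coefZ.
rewrite -['X^2 * P]commr_polyXn -['X * P]commr_polyX coefMXn coefMX /= subn2 /=.
by ring.
Qed.

(** The coefficient of X^(k+1) in Q (Q^n)' = n Q' Q^n. *)
Lemma coef_quadX_rec p q n k :
  let t i := (quad p q ^+ n)`_i in
  k.+2%:R * t k.+2 + p * k.+1%:R * t k.+1 + q * k%:R * t k
  = n%:R * (p * t k.+1 + 2 * q * t k).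
Proof.
move=> t; rewrite {}/t; set P := _ ^+ n.
have dQ : (quad p q)^`() = (2 * q) *: 'X + p%:P.
  rewrite /quad !derivD !derivZ derivXn derivX derivC addr0 alg_polyC /=.
  by rewrite -scaler_nat scalerA mulrC.
have e : quad p q * P^`() = ((quad p q)^`() * P) *+ n.
  rewrite /P deriv_exp; case: n {P} => [|n]; first by rewrite !mulr0n mulr0.
  by rewrite /= mulrnAr exprS mulrCA.
have rhsE : (((quad p q)^`() * P) *+ n)`_k.+1
    = n%:R * (p * P`_k.+1 + 2 * q * P`_k).
  rewrite dQ coefMn mulrDl coefD -scalerAl coefZ -['X * P]commr_polyX coefMX coefCM.
  by rewrite /= -mulr_natl; ring.
have := congr1 (fun A : {poly R} => A`_k.+1) e; rewrite {e}rhsE.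
case: k => [|k].
  by rewrite coef1_quadM !coef_deriv => <-; ring.
by rewrite coef_quadM !coef_deriv => <-; ring.
Qed.

(** One instance of the symmetry of Q^n under X -> 1/(q X). The differential
    recurrence at the centre already contains it, because the two coefficients
    of the middle term agree there. *)
Lemma quadX_sym p q n :
  (quad p q ^+ n.+1)`_n.+2 = q * (quad p q ^+ n.+1)`_n.
Proof.
apply: (@mulfI _ n.+2%:R); first by rewrite pnatr_eq0.
have /= := coef_quadX_rec p q n.+1 n.
by rewrite -[n.+2%:R]natr1 -[n.+1%:R]natr1; lra.
Qed.

Lemma centralS p q n :
  central p q n.+1 = p * central p q n + 2 * next_central p q n.
Proof.
rewrite /central /next_central exprS; case: n => [|n].
  by rewrite coef1_quadM !expr0 !coef1 /=; ring.
by rewrite coef_quadM !quadX_sym; ring.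
Qed.

(** Multiplying Q^n by Q brings in the coefficient of X^(n+2) of Q^n; the
    differential recurrence expresses it by the two central ones, so the system
    closes. *)
Lemma next_centralS p q n :
  n.+2%:R * next_central p q n.+1
  = n.+1%:R * (2 * q * central p q n + p * next_central p q n).
Proof.
rewrite /central /next_central exprS coef_quadM.
have /= := coef_quadX_rec p q n n.
by rewrite -[n.+2%:R]natr1 -[n.+1%:R]natr1; lra.
Qed.

Lemma central0 p q : central p q 0 = 1.
Proof. by rewrite /central expr0 coef1. Qed.

Lemma next_central0 p q : next_central p q 0 = 0.
Proof. by rewrite /next_central expr0 coef1. Qed.

Lemma central_rec p q n :
  n.+2%:R * central p q n.+2 = p * (2 * n%:R + 3) * central p q n.+1
    - (p ^+ 2 - 4 * q) * n.+1%:R * central p q n.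
Proof.
rewrite centralS mulrDr mulrCA [X in _ + X]mulrCA next_centralS.
rewrite centralS -[n.+2%:R]natr1 -[n.+1%:R]natr1.
by ring.
Qed.

(** By Lagrange inversion, q times the total weight of the Motzkin paths of
    length n whose level steps weigh p and whose down steps weigh q. *)
Definition weighted_motzkin p q n : R := next_central p q n.+1 / n.+1%:R.

Lemma weighted_motzkinE p q n :
  n.+2%:R * weighted_motzkin p q n = 2 * q * central p q n + p * next_central p q n.
Proof.
by rewrite /weighted_motzkin mulrA next_centralS mulrAC mulfV ?mul1r // pnatr_eq0.
Qed.

Lemma weighted_motzkin0 p q : weighted_motzkin p q 0 = q.
Proof.
apply: (@mulfI _ 2%:R); first by rewrite pnatr_eq0.
by rewrite weighted_motzkinE central0 next_central0 mulr0 addr0 mulr1.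
Qed.

Lemma weighted_motzkin1 p q : weighted_motzkin p q 1 = p * q.
Proof.
apply: (@mulfI _ 3%:R); first by rewrite pnatr_eq0.
rewrite weighted_motzkinE centralS central0 next_central0.
have b1 : next_central p q 1 = q.
  by rewrite -[RHS](weighted_motzkin0 p q) /weighted_motzkin divr1.
by rewrite b1; ring.
Qed.

Lemma weighted_motzkin_rec p q n :
  n.+4%:R * weighted_motzkin p q n.+2 = p * (2 * n%:R + 5) * weighted_motzkin p q n.+1
    - (p ^+ 2 - 4 * q) * n.+1%:R * weighted_motzkin p q n.
Proof.
(* Through bE the next central coefficient becomes a multiple of the preceding
   weighted Motzkin number, so weighted_motzkinE at n+1 and n+2 eliminates the
   central coefficients. *)
have bE k : next_central p q k.+1 = k.+1%:R * weighted_motzkin p q k.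
  by rewrite /weighted_motzkin mulrCA mulfV ?mulr1 // pnatr_eq0.
have := weighted_motzkinE p q n.+1; have := weighted_motzkinE p q n.+2.
rewrite centralS !bE.
rewrite -[n.+4%:R]natr1 -[n.+3%:R]natr1 -[n.+2%:R]natr1 -[n.+1%:R]natr1.
move=> -> h.
have -> : 2 * q * (p * central p q n.+1 + 2 * ((n%:R + 1) * weighted_motzkin p q n))
  = p * (2 * q * central p q n.+1) + 4 * q * (n%:R + 1) * weighted_motzkin p q n by ring.
rewrite -(addrK (p * ((n%:R + 1) * weighted_motzkin p q n)) (2 * q * central p q n.+1)).
by rewrite -h; ring.
Qed.

(** The first-order system has nonnegative coefficients, unlike the three-term
    recurrence when p ^+ 2 > 4 * q. *)
Lemma central_gt0 p q n : 0 < p -> 0 < q -> 0 < central p q n.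
Proof.
move=> p0 q0; suff: (0 < central p q n) && (0 <= next_central p q n).
  by case/andP.
elim: n => [|n /andP[W0 b0]]; first by rewrite central0 next_central0 ltr01 lexx.
rewrite centralS ltr_wpDr ?mulr_ge0 ?mulr_gt0 //=.
rewrite -(pmulr_rge0 _ (ltr0Sn R n.+1)) next_centralS.
by rewrite mulr_ge0 // addr_ge0 ?mulr_ge0 // ltW.
Qed.

Lemma weighted_motzkin_gt0 p q n : 0 < p -> 0 < q -> 0 < weighted_motzkin p q n.
Proof.
move=> p0 q0; suff: 0 < n.+2%:R * weighted_motzkin p q n by rewrite pmulr_rgt0.
elim: n => [|n IH]; rewrite weighted_motzkinE.
  by rewrite central0 next_central0 mulr0 addr0 !mulr_gt0.
rewrite addr_gt0 ?mulr_gt0 ?central_gt0 //.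
by move: IH; rewrite pmulr_rgt0 // /weighted_motzkin pmulr_lgt0 // invr_gt0.
Qed.

Lemma coef_1DX n k : ((1 + 'X : {poly R}) ^+ n)`_k = 'C(n, k)%:R.
Proof.
rewrite addrC exprD1n coef_sum.
case: (ltnP k n.+1) => kn; last first.
  rewrite bin_small // big1 // => i _; rewrite coefMn coefXn.
  by rewrite gtn_eqF ?mul0rn // (leq_trans (ltn_ord i)).
rewrite (bigD1 (Ordinal kn)) //= big1 => [|i ik].
  by rewrite coefMn coefXn eqxx addr0.
by move: ik; rewrite coefMn coefXn -val_eqE eq_sym /= => /negbTE ->; rewrite mul0rn.
Qed.

Lemma coef_1DX2 n :
  ((1 + 'X^2 : {poly R}) ^+ n)`_n.+1 = if odd n then 'C(n, n./2.+1)%:R else 0.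
Proof.
have -> : (1 + 'X^2 : {poly R}) ^+ n = ((1 + 'X) ^+ n) \Po 'X^2.
  by rewrite rmorphXn /= comp_polyD comp_polyX comp_polyC.
rewrite coef_comp_poly_Xn // dvdn2 /= negbK divn2 coef_1DX.
by case: ifP => // on; rewrite -uphalfE uphalf_half on.
Qed.

Lemma sum_odd (F : nat -> R) m :
  \sum_(i < m) (if odd i then F i else 0) = \sum_(k < m./2) F (2 * k).+1.
Proof.
elim: m => [|m IH]; first by rewrite !big_ord0.
rewrite big_ord_recr IH /= uphalf_half.
case: ifP => om; last by rewrite addr0.
by rewrite big_ord_recr /= -[in F m](odd_double_half m) om mul2n.
Qed.

End QuadraticPowers.

(** * The three sequences as central coefficients *)

Section Identification.
Variable R : realType.

Lemma trinomialE n : trinomial R n = central 1 1 n.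
Proof. by rewrite /trinomial /central /quad !scale1r. Qed.

(** Expanding (X + (1 + X^2))^(n+1) leaves only odd powers i = 2k+1 of 1 + X^2
    in degree n+2, with weight C(n+1, 2k+1) C(2k+1, k+1); two absorption
    identities turn it into (n+1) C(n, 2k) C(2k, k) / (k+1). *)
Lemma motzkinE n : motzkin R n = weighted_motzkin 1 1 n.
Proof.
rewrite /weighted_motzkin; apply: (canRL (mulfK _)); first by rewrite pnatr_eq0.
rewrite /next_central /quad !scale1r.
have -> : 'X^2 + 'X + 1 = 'X + (1 + 'X^2) :> {poly R} by ring.
rewrite exprDn coef_sum.
transitivity (\sum_(i < n.+2)
    (if odd i then 'C(n.+1, i)%:R * 'C(i, i./2.+1)%:R else 0 : R)).
  rewrite (sum_odd (fun i => 'C(n.+1, i)%:R * 'C(i, i./2.+1)%:R)) /=.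
  rewrite /motzkin mulr_suml; apply: eq_bigr => k _.
  have -> : uphalf (2 * k) = k by rewrite mul2n uphalf_double.
  have e1 : (n.+1 * 'C(n, 2 * k) = (2 * k).+1 * 'C(n.+1, (2 * k).+1))%N.
    by rewrite (mul_bin_diag n.+1).
  have e2 : ((2 * k).+1 * 'C(2 * k, k) = k.+1 * 'C((2 * k).+1, k.+1))%N.
    by rewrite (mul_bin_diag (2 * k).+1).
  have k0 : k.+1%:R != 0 :> R by rewrite pnatr_eq0.
  have k2 : (2 * k).+1%:R != 0 :> R by rewrite pnatr_eq0.
  apply: (mulfI k2); apply: (mulfI k0).
  move/(congr1 (fun x => x%:R : R)): e1; rewrite !natrM => e1.
  move/(congr1 (fun x => x%:R : R)): e2; rewrite !natrM => e2.
  transitivity ((n.+1%:R * 'C(n, 2 * k)%:R) * ((2 * k).+1%:R * 'C(2 * k, k)%:R) : R).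
    by field; rewrite nat1r.
  by rewrite e1 e2; ring.
apply: eq_bigr => i _; rewrite coefMn coefXnM.
have iln : (i <= n.+1)%N by rewrite -ltnS.
rewrite ltnNge (leq_trans (leq_subr _ _)) //=.
have -> : (n.+2 - (n.+1 - i) = i.+1)%N by lia.
rewrite coef_1DX2; case: ifP => _; last by rewrite mul0rn.
by rewrite mulr_natl.
Qed.

(** The factorisation 1 + 3X + 2X^2 = (1 + X)(X + (1 + X)) gives
    Q^m = sum_k C(m, k) X^(m-k) (1 + X)^(m+k), and in degree m+1 the k-th term
    is C(m, k) C(m+k, k+1), where C(m+k, k+1) = C(m+k, k) m / (k+1). *)
Lemma schroderE n : schroder R n.+1 = weighted_motzkin 3 2 n.
Proof.
rewrite /weighted_motzkin; apply: (canRL (mulfK _)); first by rewrite pnatr_eq0.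
set m := n.+1; rewrite /next_central /quad.
have -> : 2 *: 'X^2 + 3 *: 'X + 1 = (1 + 'X) * ('X + (1 + 'X)) :> {poly R}.
  by rewrite -!mul_polyC; ring.
rewrite exprMn [('X + _) ^+ _]exprDn mulr_sumr coef_sum /schroder mulr_suml /=.
apply: eq_bigr => k _.
rewrite [in RHS]mulrnAr coefMn [in RHS]mulrCA -exprD coefXnM coef_1DX.
have km : (k <= m)%N by rewrite -ltnS.
rewrite ltnNge (leq_trans (leq_subr _ _)) //=.
have -> : (m.+1 - (m - k) = k.+1)%N by lia.
rewrite -[RHS]mulr_natl -!mulrA; congr (_ * _).
have := mul_bin_left (m + k) k; rewrite addnK.
move/(congr1 (fun x => x%:R : R)); rewrite !natrM => e.
have k0 : k.+1%:R != 0 :> R by rewrite pnatr_eq0.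
apply: (mulfI k0); rewrite e; field.
by rewrite nat1r.
Qed.

End Identification.

(** * Windows for the quotients of consecutive terms *)

Section Windows.
Variable R : realFieldType.
Implicit Types (a : nat -> R) (lam mu al s t v w : R).

(** Nonnegative exactly when a(n+1)/a(n) >= lam (1 - al/(n+v)), provided that
    a(n) and n + v are positive; this form needs no division. *)
Definition defect (lam al v : R) a (n : nat) : R :=
  (n%:R + v) * a n.+1 - lam * (n%:R + v - al) * a n.

Definition ratio_window lam al s t a N := forall n, (N <= n)%N ->
  [/\ 0 < a n, 0 <= defect lam al s a n & defect lam al t a n <= 0].

(** The numbers lam and mu are the roots of the limiting characteristic
    equation. For |mu| < lam the dominant solutions grow like lam^n n^(-al). *)
Definition three_term (lam mu al : R) a := forall n,
  (n%:R + 2 * al + 1) * a n.+2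
  = (lam + mu) * (n%:R + al + 1) * a n.+1 - lam * mu * n.+1%:R * a n.

Definition drift lam mu al v w (n : nat) : R :=
  lam * (2 * al - v) * (n%:R + w - al) + mu * (w - 1 - al) * (n%:R + 1 + v).

(** If a(n+1)/a(n) is exactly lam (1 - al/(n+w)), comparing the next quotient
    with lam (1 - al/(n+1+v)) amounts, after clearing denominators, to the sign
    of a polynomial in n. Its higher-degree terms cancel because lam is a
    characteristic root and al the right exponent, and the drift, affine in n,
    is what remains. An error on the current quotient is transmitted with the
    factor mu. *)
Lemma defectS lam mu al v w a n : three_term lam mu al a ->
  (n%:R + 2 * al + 1) * (n%:R + w - al) * defect lam al v a n.+1
  = al * drift lam mu al v w n * a n.+1
    + n.+1%:R * (n%:R + 1 + v) * (mu * defect lam al w a n).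
Proof.
move=> /(_ n) rec; rewrite /defect.
transitivity ((n%:R + w - al) * (n.+1%:R + v) * ((n%:R + 2 * al + 1) * a n.+2)
    - (n%:R + 2 * al + 1) * (n%:R + w - al) * (lam * (n.+1%:R + v - al) * a n.+1)).
  by ring.
by rewrite rec /drift -[n.+1%:R]natr1; ring.
Qed.

Lemma defectS_coef_gt0 al v w n : 0 < al -> al < v -> al < w ->
  0 < (n%:R + 2 * al + 1) * (n%:R + w - al) /\ 0 < n.+1%:R * (n%:R + 1 + v).
Proof.
have n0 : 0 <= n%:R :> R by [].
by move=> al0 alv alw; split; rewrite mulr_gt0 //; lra.
Qed.

Lemma defectS_ge0 lam mu al v w a n : 0 < al -> al < v -> al < w ->
  three_term lam mu al a -> 0 < a n.+1 ->
  0 <= drift lam mu al v w n -> 0 <= mu * defect lam al w a n ->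
  0 <= defect lam al v a n.+1.
Proof.
move=> al0 alv alw rec an1 d e; have [den0 num0] := defectS_coef_gt0 n al0 alv alw.
rewrite -(pmulr_rge0 _ den0) (defectS v w n rec).
by rewrite addr_ge0 ?(mulr_ge0 (ltW num0)) // !mulr_ge0 // ltW.
Qed.

Lemma defectS_le0 lam mu al v w a n : 0 < al -> al < v -> al < w ->
  three_term lam mu al a -> 0 < a n.+1 ->
  drift lam mu al v w n <= 0 -> mu * defect lam al w a n <= 0 ->
  defect lam al v a n.+1 <= 0.
Proof.
move=> al0 alv alw rec an1 d e; have [den0 num0] := defectS_coef_gt0 n al0 alv alw.
rewrite -(pmulr_rle0 _ den0) (defectS v w n rec).
rewrite -oppr_ge0 opprD addr_ge0 ?oppr_ge0 //.
  by apply: mulr_le0_ge0 (ltW an1); exact: mulr_ge0_le0 (ltW al0) d.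
exact: mulr_ge0_le0 (ltW num0) e.
Qed.

(** For mu <= 0 the next quotient decreases with the current one, so each edge
    of the window is controlled by the opposite edge one step before. *)
Lemma ratio_window_neg lam mu al s t a N : 0 < al -> al < s -> al < t -> mu <= 0 ->
  three_term lam mu al a -> (forall n, 0 < a n) ->
  (forall n, (N <= n)%N -> 0 <= drift lam mu al s t n /\ drift lam mu al t s n <= 0) ->
  0 <= defect lam al s a N -> defect lam al t a N <= 0 ->
  ratio_window lam al s t a N.
Proof.
move=> al0 als alt mu0 rec a0 dr lo hi n /subnKC <-.
elim: (n - N)%N => [|k [_ IHs IHt]]; first by rewrite addn0.
have [d1 d2] := dr _ (leq_addr k N); rewrite addnS; split => //.
  by apply: (defectS_ge0 (w := t)) d1 _ => //; exact: mulr_le0.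
by apply: (defectS_le0 (w := s)) d2 _ => //; exact: mulr_le0_ge0.
Qed.

(** For mu >= 0 the next quotient increases with the current one, so each edge
    is controlled by the same edge one step before. *)
Lemma ratio_window_pos lam mu al s t a N : 0 < al -> al < s -> al < t -> 0 <= mu ->
  three_term lam mu al a -> (forall n, 0 < a n) ->
  (forall n, (N <= n)%N -> 0 <= drift lam mu al s s n /\ drift lam mu al t t n <= 0) ->
  0 <= defect lam al s a N -> defect lam al t a N <= 0 ->
  ratio_window lam al s t a N.
Proof.
move=> al0 als alt mu0 rec a0 dr lo hi n /subnKC <-.
elim: (n - N)%N => [|k [_ IHs IHt]]; first by rewrite addn0.
have [d1 d2] := dr _ (leq_addr k N); rewrite addnS; split => //.
  by apply: (defectS_ge0 (w := s)) d1 _ => //; exact: mulr_ge0.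
by apply: (defectS_le0 (w := t)) d2 _ => //; exact: mulr_ge0_le0.
Qed.

End Windows.

(** * From quotient windows to slopes *)

Section Slopes.
Variable R : realType.
Implicit Types (a : nat -> R) (lam al s t u v x y z : R).

Definition slope a n : R := ln (a n.+1) - ln (a n).

Lemma ln_ratio_le u v : 0 < u -> 0 < v -> ln u - ln v <= u / v - 1.
Proof.
move=> u0 v0; rewrite -ln_div ?posrE //.
have := @le_ln1Dx R (u / v - 1); rewrite addrCA subrr addr0; apply.
by rewrite ltrBrDl subrr divr_gt0.
Qed.

Lemma slope_diff_le x y z : 0 < x -> 0 < y -> 0 < z ->
  ln z - ln y - (ln y - ln x) <= z / y * (x / y) - 1.
Proof.
move=> x0 y0 z0; have := @ln_ratio_le (z / y) (y / x).
by rewrite !ln_div ?posrE // invf_div; apply; rewrite divr_gt0.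
Qed.

Lemma slope_diff_ge x y z : 0 < x -> 0 < y -> 0 < z ->
  1 - y / x * (y / z) <= ln z - ln y - (ln y - ln x).
Proof.
move=> x0 y0 z0; have := @ln_ratio_le (y / x) (z / y).
by rewrite !ln_div ?posrE // invf_div !divr_gt0 // => /(_ isT isT); lra.
Qed.

(** With q(n) = a(n+1)/a(n), the difference of slopes is ln (q(n+1)/q(n)), and
    1 - 1/x <= ln x <= x - 1. The lower bound uses the upper edge at n and the
    lower edge at n+1, which leaves al (1 + s - t) over a quadratic in n: this
    is where the window must be shorter than one step. *)
Lemma slope_of_window lam al s t a N : (0 < N)%N -> 0 < lam -> 0 < al ->
  al <= s -> s <= t -> t < s + 1 -> ratio_window lam al s t a N ->
  forall n, (N <= n)%N -> [/\ 0 < a n,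
    al * (1 + s - t) / ((1 + t) * (1 + s)) <= n.+1%:R ^+ 2 * (slope a n.+1 - slope a n) &
    n%:R * n.+1%:R * (slope a n.+1 - slope a n) <= al * (1 + t - s)].
Proof.
move=> N0 l0 al0 als st ts win n Nn.
have [x0 lo1 hi1] := win n Nn; have [y0 lo2 hi2] := win n.+1 (leqW Nn).
have [z0 _ _] := win n.+2 (leqW (leqW Nn)).
move: lo1 hi1 lo2 hi2; rewrite /defect /slope -[n.+1%:R]natr1.
have n1 : 1 <= n%:R :> R by rewrite ler1n (leq_trans N0).
move: (a n) (a n.+1) (a n.+2) (n%:R : R) x0 y0 z0 n1.
move=> x y z m x0 y0 z0 m1 lo1 hi1 lo2 hi2; split=> //.
- have xy : y / x <= lam * ((m + t - al) / (m + t)).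
    by rewrite ler_pdivrMr // mulrA mulrAC ler_pdivlMr; lra.
  have yz : y / z <= lam^-1 * ((m + 1 + s) / (m + 1 + s - al)).
    by rewrite ler_pdivrMr // -mulrA ler_pdivlMl // mulrAC ler_pdivlMr; lra.
  have h : y / x * (y / z) <= 1 - al * (1 + s - t) / ((m + t) * (m + 1 + s - al)).
    apply: le_trans (ler_pM _ _ xy yz) _; rewrite ?(ltW (divr_gt0 _ _)) //.
    rewrite le_eqVlt; apply/orP; left; apply/eqP; field; lra.
  have lb := slope_diff_ge x0 y0 z0.
  have k0 : 0 <= al * (1 + s - t) by rewrite mulr_ge0; lra.
  apply: (@le_trans _ _ ((m + 1) ^+ 2 * (al * (1 + s - t) / ((m + t) * (m + 1 + s - al))))).
    rewrite mulrCA ler_wpM2l // ler_pdivlMr ?mulr_gt0; try lra.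
    rewrite mulrC ler_pdivrMr ?mulr_gt0; try lra.
    have -> : (m + 1) ^+ 2 * ((1 + t) * (1 + s)) = ((1 + t) * (m + 1)) * ((1 + s) * (m + 1)).
      by ring.
    by apply: ler_pM; nra.
  by rewrite ler_wpM2l ?exprn_ge0; lra.
- have zy : z / y <= lam * ((m + 1 + t - al) / (m + 1 + t)).
    by rewrite ler_pdivrMr // mulrA mulrAC ler_pdivlMr; lra.
  have xy : x / y <= lam^-1 * ((m + s) / (m + s - al)).
    by rewrite ler_pdivrMr // -mulrA ler_pdivlMl // mulrAC ler_pdivlMr; lra.
  have h : z / y * (x / y) <= 1 + al * (1 + t - s) / ((m + 1 + t) * (m + s - al)).
    apply: le_trans (ler_pM _ _ zy xy) _; rewrite ?(ltW (divr_gt0 _ _)) //.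
    rewrite le_eqVlt; apply/orP; left; apply/eqP; field; lra.
  have ub := slope_diff_le x0 y0 z0.
  have k0 : 0 <= al * (1 + t - s) by rewrite mulr_ge0; lra.
  apply: (@le_trans _ _ (m * (m + 1) * (al * (1 + t - s) / ((m + 1 + t) * (m + s - al))))).
    by rewrite ler_wpM2l ?mulr_ge0; lra.
  rewrite mulrCA ler_piMr // ler_pdivrMr ?mulr_gt0 ?mul1r; try lra.
  by rewrite mulrC; apply: ler_pM; lra.
Qed.

End Slopes.

(** * Monotonicity of roots and of their ratios *)

Section Roots.
Variable R : realType.
Implicit Types a : nat -> R.

Definition roots_increase_ratios_decrease a n0 :=
  increasing_seq (fun k => nth_root_seq a (n0 + k)%N) /\
  decreasing_seq (fun k => ratio_seq (nth_root_seq a) (n0 + k)%N).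

(** Up to the factor 1 / (n (n+1)), the increment of ln (a n) / n. *)
Definition gap a n : R := n%:R * ln (a n.+1) - n.+1%:R * ln (a n).

Lemma gapS a n : gap a n.+1 = gap a n + n.+1%:R * (slope a n.+1 - slope a n).
Proof. by rewrite /gap /slope -[n.+2%:R]natr1 -[n.+1%:R]natr1; ring. Qed.

Lemma nth_root_seqE a n : 0 < a n -> nth_root_seq a n = expR (ln (a n) / n%:R).
Proof. by move=> an; rewrite /nth_root_seq /powR gt_eqF // mulrC. Qed.

Lemma ratio_seqE a n : (0 < n)%N -> 0 < a n -> 0 < a n.+1 ->
  ratio_seq (nth_root_seq a) n = expR (gap a n / (n%:R * n.+1%:R)).
Proof.
move=> n0 an an1; rewrite /ratio_seq !nth_root_seqE // -expRB; congr expR.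
rewrite /gap; field.
by rewrite nat1r !pnatr_eq0 /= -lt0n.
Qed.

Lemma roots_ratios_of_gap a n0 : (0 < n0)%N ->
  (forall n, (n0 <= n)%N -> [/\ 0 < a n, 0 < gap a n &
     n%:R * n.+1%:R * (slope a n.+1 - slope a n) < 2 * gap a n]) ->
  roots_increase_ratios_decrease a n0.
Proof.
move=> n00 H; split.
- apply/increasing_seqP => k; rewrite addnS; set n := (n0 + k)%N.
  have nn : (n0 <= n)%N by rewrite leq_addr.
  have [an gn _] := H _ nn; have [an1 _ _] := H _ (leqW nn).
  have n_gt0 : 0 < n%:R :> R by rewrite ltr0n (leq_trans n00).
  rewrite !nth_root_seqE // ltr_expR ltr_pdivrMr // mulrAC ltr_pdivlMr //.
  by move: gn; rewrite /gap; lra.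
- apply/decreasing_seqP => k; rewrite addnS; set n := (n0 + k)%N.
  have nn : (n0 <= n)%N by rewrite leq_addr.
  have [an gn hn] := H _ nn; have [an1 gn1 _] := H _ (leqW nn).
  have [an2 _ _] := H _ (leqW (leqW nn)).
  have n_gt0 : 0 < n%:R :> R by rewrite ltr0n (leq_trans n00).
  rewrite !ratio_seqE //; last by rewrite (leq_trans n00).
  rewrite ltr_expR.
  rewrite ltr_pdivrMr ?mulr_gt0 // mulrAC ltr_pdivlMr ?mulr_gt0 //.
  move: hn; rewrite gapS -[n.+2%:R]natr1.
  set d := slope _ _ - _; set m := n.+1%:R; set x := n%:R.
  have mE : m = x + 1 by rewrite /m -natr1.
  have m_gt0 : 0 < m by rewrite ltr0n.
  move=> hn.
  have -> : (gap a n + m * d) * (x * m) = m * (x * gap a n + x * m * d) by ring.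
  have -> : gap a n * (m * (m + 1)) = m * (x * gap a n + 2 * gap a n).
    by rewrite mE; ring.
  by rewrite ltr_pM2l // ltrD2l.
Qed.

(** The increments of the gap are at least c / (n+1) >= c ln ((n+2)/(n+1)), so
    the gap minus c ln (n+1) does not decrease and the gap is unbounded. *)
Lemma roots_ratios_of_slope a (c C : R) N : 0 < c ->
  (forall n, (N <= n)%N -> [/\ 0 < a n,
     c <= n.+1%:R ^+ 2 * (slope a n.+1 - slope a n) &
     n%:R * n.+1%:R * (slope a n.+1 - slope a n) <= C]) ->
  exists n1, forall n0, (n1 <= n0)%N -> (0 < n0)%N -> roots_increase_ratios_decrease a n0.
Proof.
move=> c0 H.
have gap_ge k : gap a N - c * ln N.+1%:R <= gap a (N + k)%N - c * ln (N + k).+1%:R.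
  elim: k => [|k IH]; first by rewrite addn0.
  apply: (le_trans IH); rewrite addnS gapS; set n := (N + k)%N.
  have [_ lb _] := H n (leq_addr _ _).
  have m_gt0 : 0 < n.+1%:R :> R by rewrite ltr0n.
  have e : ln n.+2%:R = ln n.+1%:R + ln (1 + n.+1%:R^-1) :> R.
    rewrite -lnM ?posrE ?addr_gt0 ?invr_gt0 //; congr ln.
    by rewrite mulrDr mulr1 mulfV ?gt_eqF // natr1.
  have l1 : ln (1 + n.+1%:R^-1) <= n.+1%:R^-1 :> R.
    by apply: le_ln1Dx; rewrite (lt_trans (ltrN10 _)) // invr_gt0.
  have l2 : c / n.+1%:R <= n.+1%:R * (slope a n.+1 - slope a n).
    by rewrite ler_pdivrMr // mulrAC -expr2.
  have l3 : c * ln (1 + n.+1%:R^-1) <= c / n.+1%:R by rewrite ler_pM2l.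
  by have := le_trans l3 l2; rewrite e; set u := _ * (_ - _); set v := ln (1 + _); lra.
(* For ln (n+1) > K the logarithmic lower bound exceeds both 0 and C. *)
pose K : R := (Num.max 0 C - gap a N + c * ln N.+1%:R) / c.
pose n1 := maxn N (Num.truncn (expR K)).+1.
exists n1 => n0 n10 n00; apply: roots_ratios_of_gap => // n n0n.
have n1n := leq_trans n10 n0n.
have Nn : (N <= n)%N := leq_trans (leq_maxl _ _) n1n.
have [an _ ub] := H n Nn.
have gapgt : Num.max 0 C < gap a n.
  have := gap_ge (n - N)%N; rewrite subnKC //.
  have : K < ln n.+1%:R.
    rewrite -[K]expRK ltr_ln ?posrE ?expR_gt0 //.
    apply: (lt_le_trans (truncnS_gt _)); rewrite ler_nat.
    by rewrite (leq_trans (leq_maxr N _)) // (leq_trans n1n).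
  rewrite /K ltr_pdivrMr // => h1 h2.
  by move: h1 h2; set x := Num.max _ _; lra.
split=> //; last first.
  by apply: le_lt_trans ub _; move: (gapgt); rewrite gt_max; lra.
by move: gapgt; rewrite gt_max => /andP[g0 _]; lra.
Qed.

Lemma roots_ratios_of_window a (lam al s t : R) N : (0 < N)%N -> 0 < lam ->
  0 < al -> al <= s -> s <= t -> t < s + 1 -> ratio_window lam al s t a N ->
  exists n1, forall n0, (n1 <= n0)%N -> (0 < n0)%N ->
    roots_increase_ratios_decrease a n0.
Proof.
move=> N0 lam0 al0 als st ts win.
apply: (roots_ratios_of_slope _ (slope_of_window N0 lam0 al0 als st ts win)).
by rewrite divr_gt0 // mulr_gt0 //; lra.
Qed.

End Roots.

(** * The windows of the three sequences *)

Section ThreeSequences.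
Variable R : realType.

(** Here lam = 3, mu = -1, al = 1/2, and the quotients are
    3 (1 - al/(n + 9/8)) + O(1/n^3); the window is centred at 9/8. The quotient
    51/19 at n = 4 lies exactly on its lower edge. *)
Lemma trinomial_window :
  ratio_window 3 (1 / 2) (3 / 4) (3 / 2) (@trinomial R) 4.
Proof.
have rec n := central_rec (1 : R) 1 n.
have W0 := central0 (1 : R) 1.
have W1 : central (1 : R) 1 1 = 1.
  by rewrite centralS central0 next_central0 mulr0 addr0 mulr1.
have W4 : trinomial R 4 = 19.
  by rewrite trinomialE; move: (rec 0%N) (rec 1%N) (rec 2%N); lra.
have W5 : trinomial R 5 = 51.
  by move: W4; rewrite !trinomialE; move: (rec 1%N) (rec 2%N) (rec 3%N); lra.
apply: (@ratio_window_neg _ _ (-1)); rewrite /defect ?W4 ?W5; try lra.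
- move=> n; rewrite !trinomialE; have := rec n.
  by rewrite -[n.+2%:R]natr1 -[n.+1%:R]natr1; lra.
- by move=> n; rewrite trinomialE central_gt0.
- move=> n n4; have : 4%:R <= n%:R :> R by rewrite ler_nat.
  by rewrite /drift => ?; split; lra.
Qed.

(** Here lam = 3, mu = -1, al = 3/2, and the quotients are
    3 (1 - al/(n + 23/8)) + O(1/n^3); the window is centred at 23/8. *)
Lemma motzkin_window :
  ratio_window 3 (3 / 2) (5 / 2) (13 / 4) (@motzkin R) 3.
Proof.
have rec n := weighted_motzkin_rec (1 : R) 1 n.
have V0 := weighted_motzkin0 (1 : R) 1; have V1 := weighted_motzkin1 (1 : R) 1.
have V3 : motzkin R 3 = 4.
  by rewrite motzkinE; move: (rec 0%N) (rec 1%N); lra.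
have V4 : motzkin R 4 = 9.
  by move: V3; rewrite !motzkinE; move: (rec 0%N) (rec 2%N); lra.
apply: (@ratio_window_neg _ _ (-1)); rewrite /defect ?V3 ?V4; try lra.
- move=> n; rewrite !motzkinE; have := rec n.
  rewrite -[n.+4%:R]natr1 -[n.+3%:R]natr1 -[n.+2%:R]natr1 -[n.+1%:R]natr1.
  by lra.
- by move=> n; rewrite motzkinE weighted_motzkin_gt0.
- move=> n n3; have : 3%:R <= n%:R :> R by rewrite ler_nat.
  by rewrite /drift => ?; split; lra.
Qed.

(** Here lam = 3 + 2 sqrt 2, mu = 3 - 2 sqrt 2, al = 3/2. The recurrence holds
    in the index n of weighted_motzkin, one less than the Schroder index, which
    lowers both shifts by 1. *)
Lemma schroder_window :
  ratio_window (3 + 2 * Num.sqrt 2) (3 / 2) (3 / 2) (9 / 4) (@schroder R) 1.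
Proof.
set r : R := Num.sqrt 2.
have r2 : r ^+ 2 = 2 by rewrite sqr_sqrtr.
have r0 : 0 <= r by exact: sqrtr_ge0.
(* These crude bounds give mu <= 2/5 and lam >= 28/5, enough for the drift to be
   negative at the upper edge and for the initial quotient 3 to lie below it. *)
have rl : 13 / 10 <= r by nra.
have ru : r <= 3 / 2 by nra.
have rec n := weighted_motzkin_rec (3 : R) 2 n.
have V0 := weighted_motzkin0 (3 : R) 2; have V1 := weighted_motzkin1 (3 : R) 2.
have win : ratio_window (3 + 2 * r) (3 / 2) (5 / 2) (13 / 4) (weighted_motzkin (3 : R) 2) 0.
  apply: (@ratio_window_pos _ _ (3 - 2 * r)); rewrite /defect ?V0 ?V1; try lra.
  - move=> n.
    have -> : (3 + 2 * r) * (3 - 2 * r) = 1 :> R by nra.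
    have := rec n.
    rewrite -[n.+4%:R]natr1 -[n.+3%:R]natr1 -[n.+2%:R]natr1 -[n.+1%:R]natr1.
    by lra.
  - by move=> n; rewrite weighted_motzkin_gt0.
  - by move=> n _; have n0 : 0 <= n%:R :> R by []; rewrite /drift; split; nra.
case=> // n _; have := win n (leq0n n).
rewrite /defect !schroderE -[n.+1%:R]natr1.
by move=> [? ? ?]; split=> //; lra.
Qed.

End ThreeSequences.

Theorem theorem4 (R : realType) :
  exists n0 : nat, (0 < n0)%N /\
    [/\ increasing_seq (fun k => nth_root_seq (@motzkin R) (n0 + k)%N),
        increasing_seq (fun k => nth_root_seq (@schroder R) (n0 + k)%N) &
        increasing_seq (fun k => nth_root_seq (@trinomial R) (n0 + k)%N)] /\
    [/\ decreasing_seq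
          (fun k => ratio_seq (nth_root_seq (@motzkin R)) (n0 + k)%N),
        decreasing_seq
          (fun k => ratio_seq (nth_root_seq (@schroder R)) (n0 + k)%N) &
        decreasing_seq
          (fun k => ratio_seq (nth_root_seq (@trinomial R)) (n0 + k)%N)].
Proof.
have lam0 : 0 < 3 + 2 * Num.sqrt 2 :> R by rewrite ltr_wpDr ?mulr_ge0 ?sqrtr_ge0.
have [| | | | | |nM HM] := roots_ratios_of_window _ _ _ _ _ _ (motzkin_window R); try lra.
  by [].
have [| | | | | |nS HS] := roots_ratios_of_window _ _ _ _ _ _ (schroder_window R); try lra.
  by [].
have [| | | | | |nT HT] := roots_ratios_of_window _ _ _ _ _ _ (trinomial_window R); try lra.
  by [].
pose n0 := (nM + nS + nT).+1; have n00 : (0 < n0)%N by [].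
have [|incM decM] := HM n0 _ n00; first by rewrite /n0; lia.
have [|incS decS] := HS n0 _ n00; first by rewrite /n0; lia.
have [|incT decT] := HT n0 _ n00; first by rewrite /n0; lia.
by exists n0; do !split.
Qed.
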